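(* Let $(X,\|\cdot\|)$ be a normed space and let $F:X\rightrightarrows X$ be a set-valued mapping. Let $U\subset X$ be a nonempty open set and let $L\subset S_X$ be nonempty. Assume that: (i) $F$ is directionally orbitally regular on $U$ w.r.t. $L$ and w.r.t. $-L$ with constant $\tau\in(0,1)$; (ii) there exists $\overline{x}\in U$ such that one of the following conditions holds: $(\alpha)$ $T_L(\overline{x},F^{-1}(\overline{x}))<(1-\tau)\mathbf{d}(\overline{x},X\setminus U)$; $(\beta)$ $T_{-L}(\overline{x},F^{-1}(\overline{x}))<(1-\tau)\mathbf{d}(\overline{x},X\setminus U)$. Then the following assertions hold. (a) There exists a sequence $(x_k)_{k\in\mathbb{N}}\subset X$ of successive approximations of $F^{-1}$ starting from $\overline{x}$ w.r.t. $L$ such that, for every $\varepsilon>0$, there exists $k_\varepsilon\in\mathbb{N}$ such that for all $k\ge k_\varepsilon$, $$x_k\in\operatorname{Fix}(F)(\varepsilon)\cap U,$$ and, moreover, either $T_L(x_k,F(x_k))<\varepsilon$ or $T_{-L}(x_k,F(x_k))<\varepsilon$. Furthermore, for every $\varepsilon>0$, if $(\alpha)$ holds, then $$\mathbf{d}\bigl(\overline{x},\operatorname{Fix}(F)(\varepsilon)\cap U\bigr)\le\frac{T_L(\overline{x},F^{-1}(\overline{x}))}{1-\tau},$$ whereas if $(\beta)$ holds, then $$\mathbf{d}\bigl(\overline{x},\operatorname{Fix}(F)(\varepsilon)\cap U\bigr)\le\frac{T_{-L}(\overline{x},F^{-1}(\overline{x}))}{1-\tau}.$$ (b) If $X$ is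 a Banach space and $F$ has closed graph, then $\operatorname{Fix}(F)\cap U\neq\emptyset$. Moreover, if $(\alpha)$ holds, then $$\mathbf{d}\bigl(\overline{x},\operatorname{Fix}(F)\cap U\bigr)\le\frac{T_L(\overline{x},F^{-1}(\overline{x}))}{1-\tau},$$ while if $(\beta)$ holds, then $$\mathbf{d}\bigl(\overline{x},\operatorname{Fix}(F)\cap U\bigr)\le\frac{T_{-L}(\overline{x},F^{-1}(\overline{x}))}{1-\tau}.$$
   Context: $S_X$ is the unit sphere of $X$; $\mathbf{d}(x,A)=\inf_{a\in A}\|x-a\|$ with $\mathbf{d}(x,\emptyset)=+\infty$; $F^{-1}(y)=\{x:y\in F(x)\}$. For $\emptyset\ne L\subset S_X$ and $A\subset X$, the directional minimal time function is $T_L(x,A):=\inf\{t\ge 0:(x+tL)\cap A\ne\emptyset\}$ with $\inf\emptyset=+\infty$. $\operatorname{Fix}(F)(\varepsilon):=\{x\in X:\mathbf{d}(x,F(x))\le\varepsilon\}$ and $\operatorname{Fix}(F):=\{x\in X:x\in F(x)\}$. A sequence $(x_k)_{k\in\mathbb{N}}\subset X$ is a sequence of successive approximations of $H:X\rightrightarrows X$ starting from $\overline{x}$ w.r.t. $L$ if there exist sequences $(t_k)\subset\mathbb{R}$ (signs allowed) and $(u_k)\subset L$ such that $x_0=\overline{x}$, $t_k\to0$, and $x_{k+1}=x_k+t_ku_k\in H(x_k)$ for all $k\in\mathbb{N}$. $F$ is directionally orbitally regular on $U$ w.r.t. $L$ with constant $\tau>0$ if for every $x\in U$: $\tau T_L(x,F(x))<\mathbf{d}(x,X\setminus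 U)\Rightarrow T_L(x,F^{-1}(x))\le\tau T_L(x,F(x))$. *)

(* Defs.v *)
From HB Require Import structures.
From mathcomp Require Import all_boot all_order all_algebra.
From mathcomp Require Import all_classical all_reals all_analysis.

Set Implicit Arguments.
Unset Strict Implicit.
Unset Printing Implicit Defensive.

Import Order.TTheory GRing.Theory Num.Theory.
Import numFieldNormedType.Exports.

Local Open Scope classical_set_scope.
Local Open Scope ring_scope.

(* A set-valued mapping X =>> X is a function H : X -> set X. In \bar R,
   ereal_inf set0 = +oo, which is the convention inf set0 = +oo used for both
   ndist and min_time. *)
Section directional.
Context {R : realType} {X : normedModType R}.

Definition unit_sphere : set X := [set u | `|u| = 1].

Definition ndist (x : X) (A : set X) : \bar R :=
  ereal_inf [set `|x - a|%:E | a in A].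

Definition inv_map (H : X -> set X) : X -> set X := fun y => [set x | H x y].

Definition graph_map (H : X -> set X) : set (X * X) :=
  [set p | H p.1 p.2].

Definition opp_set (L : set X) : set X := [set - u | u in L].

Definition min_time (L : set X) (x : X) (A : set X) : \bar R :=
  ereal_inf
    [set t%:E | t in
      [set t : R | 0 <= t /\ [set x + t *: u | u in L] `&` A !=set0]].

Definition approx_fix (H : X -> set X) (eps : R) : set X :=
  [set x | (ndist x (H x) <= eps%:E)%E].

Definition fix_set (H : X -> set X) : set X := [set x | H x x].

Definition successive_approx (H : X -> set X) (L : set X) (x0 : X)
    (x : nat -> X) : Prop :=
  exists (t : nat -> R) (u : nat -> X),
    [/\ x 0%N = x0,
        t @ \oo --> (0 : R),
        forall k, L (u k) &
        forall k, x k.+1 = x k + t k *: u k /\ H (x k) (x k.+1)].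

Definition dir_orbitally_regular (H : X -> set X) (U L : set X) (tau : R) :
    Prop :=
  0 < tau /\
  forall x, U x ->
    (tau%:E * min_time L x (H x) < ndist x (~` U))%E ->
    (min_time L x (inv_map H x) <= tau%:E * min_time L x (H x))%E.

(* The field cauchy_cvg of the structure of complete uniform spaces, as a
   property of X, so that completeness can be assumed in part of a statement. *)
Definition is_banach : Prop :=
  forall G : set_system X, ProperFilter G -> cauchy G -> cvg G.

End directional.

Arguments unit_sphere {R} X.
Arguments is_banach {R} X.

(* Main.v *)
(* If [x' = x + t u] lies in [F^-1 x], then [x] lies in [F x'] and is reached from
   [x'] in time [t] along [-u]. Orbital regularity with respect to [-L] at [x']
   therefore yields a next point of [F^-1 x'] at time at most [q t], for any
   [q > tau]. Iterating, with directions alternating between [L] and [-L], gives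
   an orbit with geometrically decreasing steps; choosing the first step [t_0]
   close to the minimal time and [q] close to [tau], the orbit stays within
   [t_0 / (1 - q) < d (xbar, X \ U)] of [xbar]. Its points are almost fixed, and
   its limit is fixed when the space is complete and the graph closed. *)

Require Import Defs.
From HB Require Import structures.
From mathcomp Require Import all_boot all_order all_algebra.
From mathcomp Require Import all_classical all_reals all_analysis.
From mathcomp Require Import ring lra.

Set Implicit Arguments.
Unset Strict Implicit.

Import Order.TTheory GRing.Theory Num.Theory.
Import numFieldNormedType.Exports.

Local Open Scope classical_set_scope.
Local Open Scope ring_scope.

(** * Real numbers interpolated in extended inequalities *)

Lemma lte_fin_between (R : realFieldType) (r : R) (e : \bar R) :
  (r%:E < e)%E -> exists2 s, r < s & (s%:E < e)%E.
Proof.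
case: e => [d| |] //; rewrite ?lte_fin => rd.
  by exists ((r + d) / 2); rewrite ?lte_fin; lra.
by exists (r + 1); [lra | rewrite ltry].
Qed.

(** Turns a condition such as [T < (1 - tau) d] into a real radius [r]; [D] may be infinite, as
    happens when [U] is the whole space. *)
Lemma lte_fin_mul_between (R : realFieldType) (a : R) (T D : \bar R) :
  0 < a -> (0 <= T)%E -> (T < a%:E * D)%E ->
  exists2 r, (T < (a * r)%:E)%E & (r%:E < D)%E.
Proof.
move=> a0; case: T => [T| |] //; last by move=> _; rewrite ltNge leey.
move=> _; rewrite -lte_pdivrMl // -EFinM => /lte_fin_between[r Tr rD].
by exists r => //; rewrite lte_fin -ltr_pdivrMl.
Qed.

(** * Distance to a set and directional minimal time *)

Section distances.
Context {R : realType} {X : normedModType R}.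
Implicit Types (x y : X) (A L : set X) (H : X -> set X).

Lemma ndist_le x A a : A a -> (ndist x A <= `|x - a|%:E)%E.
Proof. by move=> Aa; apply: ereal_inf_lbound; exists a. Qed.

Lemma ndist_gt_mem x U (r : R) y :
  (r%:E < ndist x (~` U))%E -> `|x - y| <= r -> U y.
Proof.
move=> rU xyr; apply: contrapT => nUy.
have := lt_le_trans rU (@ndist_le x (~` U) y nUy).
by rewrite lte_fin ltNge xyr.
Qed.

Lemma ndist_gt_shift x A (r : R) y (s : R) :
  (r%:E < ndist x A)%E -> `|x - y| + s <= r -> (s%:E < ndist y A)%E.
Proof.
(* An infimum only inherits non-strict bounds; the slack [r' - r] restores strictness. *)
move=> /lte_fin_between[r' rr' r'A] xysr.
apply: (@lt_le_trans _ _ (r' - r + s)%:E); first by rewrite lte_fin; lra.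
apply: le_ereal_inf_tmp => _ [a Aa <-]; rewrite lee_fin.
have := lt_le_trans r'A (ndist_le x Aa); rewrite lte_fin.
have := ler_distD y x a; lra.
Qed.

Lemma min_time_ge0 L x A : (0 <= min_time L x A)%E.
Proof. by apply: le_ereal_inf_tmp => _ [t [t0 _] <-]; rewrite lee_fin. Qed.

Lemma min_time_lt L x A (c : R) : (min_time L x A < c%:E)%E ->
  exists t u, [/\ 0 <= t, t < c, L u & A (x + t *: u)].
Proof.
move=> /ereal_inf_lt[_ [t [t0 [_ [[u Lu <-] Axu]]] <-]]; rewrite lte_fin => tc.
by exists t, u.
Qed.

Lemma min_time_le L x A (t : R) u :
  0 <= t -> L u -> A (x + t *: u) -> (min_time L x A <= t%:E)%E.
Proof.
move=> t0 Lu Axu; apply: ereal_inf_lbound; exists t => //; split=> //.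
by exists (x + t *: u); split=> //; exists u.
Qed.

Lemma ndist_le_min_time L x A :
  L `<=` unit_sphere X -> (ndist x A <= min_time L x A)%E.
Proof.
move=> L1; apply: le_ereal_inf_tmp => _ [t [t0 [_ [[u Lu <-] Axu]]] <-].
apply: le_trans (ndist_le x Axu) _; rewrite lee_fin.
by rewrite opprD addrA subrr add0r normrN normrZ (L1 _ Lu) mulr1 ger0_norm.
Qed.

(** If the distance to [A] exceeded [T / (1 - tau)], some real [r] would lie above that quotient and
    below both distances; the point of [A] supplied for this [r] is then too close. *)
Lemma ndist_le_div A x U (T : \bar R) (tau : R) : tau < 1 -> (0 <= T)%E ->
  (T < (1 - tau)%:E * ndist x (~` U))%E ->
  (forall r, (T < ((1 - tau) * r)%:E)%E -> (r%:E < ndist x (~` U))%E ->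
    exists2 a, A a & `|x - a| <= r) ->
  (ndist x A <= T / (1 - tau)%:E)%E.
Proof.
move=> tau1 T0 TU hA; have tau1' : 0 < 1 - tau by rewrite subr_gt0.
rewrite leNgt; apply/negP; rewrite inver gt_eqF // muleC lte_pdivrMl // => TA.
have := @lte_fin_mul_between _ (1 - tau) T (mine (ndist x A) (ndist x (~` U))).
case=> //; first by rewrite minElt; case: ifP.
move=> r Tr; rewrite lt_min => /andP[rA rU].
have [a Aa xar] := hA r Tr rU.
have := lt_le_trans rA (ndist_le x Aa).
by rewrite lte_fin ltNge xar.
Qed.

End distances.

(** * Sequences whose steps decay geometrically *)

Section geometric_steps.
Context {R : realType} {X : normedModType R}.
Variables (x : nat -> X) (t : nat -> R) (q : R).
Hypotheses (q01 : 0 < q < 1) (t0 : forall k, 0 <= t k).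
Hypothesis tq : forall k, t k.+1 <= q * t k.
Hypothesis xt : forall k, `|x k - x k.+1| <= t k.

(** Division-free form of the tail bound [t k / (1 - q)]; keeping [t (k + j)] on the left makes the
    induction on [j] close. *)
Lemma geometric_steps_dist k j :
  `|x k - x (k + j)%N| * (1 - q) + t (k + j)%N <= t k.
Proof.
have /andP[q0 q1] := q01.
elim: j => [|j IH]; first by rewrite addn0 subrr normr0 mul0r add0r.
rewrite addnS.
have := ler_distD (x (k + j)%N) (x k) (x (k + j).+1).
by have := xt (k + j); have := tq (k + j); nra.
Qed.

Lemma geometric_steps_cvg0 : t @ \oo --> (0 : R).
Proof.
have /andP[q0 q1] := q01.
have tk k : t k <= t 0 * q ^+ k.
  elim: k => [|k IH]; first by rewrite expr0 mulr1.
  by rewrite exprS mulrCA (le_trans (tq k)) // ler_pM2l.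
apply: (@squeeze_cvgr _ _ _ _ (fun=> 0) (geometric (t 0) q)).
- by apply: nearW => k; rewrite t0 tk.
- exact: cvg_cst.
- by apply: cvg_geometric; rewrite gtr0_norm.
Qed.

Lemma geometric_steps_cauchy : cauchy (x @ \oo).
Proof.
have /andP[q0 q1] := q01.
apply: cauchy_exP => e e0.
have e0' : 0 < e * (1 - q) by rewrite mulr_gt0 ?subr_gt0.
have [N _ tN] := cvgr_lt _ geometric_steps_cvg0 _ e0'.
exists (x N); exists N => // k /= Nk.
rewrite -ball_normE /= -(@ltr_pM2r _ (1 - q)) ?subr_gt0 //.
have := geometric_steps_dist N (k - N); rewrite subnKC //.
by have := t0 k; have /= := tN N (leqnn N); lra.
Qed.

End geometric_steps.

(** The boolean treats [L] and [-L] together: reversing a direction becomes negation. *)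
Definition signed_set {R : realType} {X : normedModType R} (L : set X)
  (b : bool) : set X := if b then opp_set L else L.

(** * Orbits of the inverse map with alternating directions *)

Section orbit.
Context {R : realType} {X : normedModType R}.
Variables (F : X -> set X) (U L : set X) (tau : R).
Hypotheses (tau1 : tau < 1) (L1 : L `<=` unit_sphere X).
Hypothesis regF : forall b, dir_orbitally_regular F U (signed_set L b) tau.

Local Notation S := (signed_set L).

Lemma signed_set_norm b u : S b u -> `|u| = 1.
Proof.
by case: b => [[v Lv <-]|Lu]; [rewrite normrN; exact: L1 | exact: L1].
Qed.

Lemma signed_setN b u : S b u -> S (~~ b) (- u).
Proof. by case: b => /= [[v Lv <-]|Lu]; [rewrite opprK|exists u]. Qed.

(** Going back along [- u] leads from the new point to [x], which lies in its image under [F]. *)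
Lemma min_time_step b x t u : 0 <= t -> S b u -> F (x + t *: u) x ->
  (min_time (S (~~ b)) (x + t *: u)%R (F (x + t *: u)%R) <= t%:E)%E.
Proof.
move=> t0 Su Fx; apply: (@min_time_le _ _ _ _ _ _ (- u)) => //.
  exact: signed_setN.
by rewrite scalerN addrK.
Qed.

Lemma approx_fix_step b x t u : 0 <= t -> S b u -> F (x + t *: u) x ->
  approx_fix F t (x + t *: u).
Proof.
move=> t0 Su Fx; apply: le_trans (min_time_step t0 Su Fx).
by apply: ndist_le_min_time => v; exact: signed_set_norm.
Qed.

(* A null step can be repeated forever: the infimum [tau * t = 0] given by
   orbital regularity need not be attained, but then [x] is a fixed point. *)
Lemma next_step b x t u q : tau < q -> 0 <= t -> S b u ->
    F (x + t *: u) x -> U (x + t *: u) ->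
    ((q * t)%:E < ndist (x + t *: u)%R (~` U))%E ->
  exists t' u', [/\ 0 <= t', t' <= q * t, S (~~ b) u' &
    F (x + t *: u + t' *: u') (x + t *: u)].
Proof.
move=> tauq t0 Su Fx Uy qtU; have [tau0 regb] := regF (~~ b).
have [t0'|tn0] := eqVneq t 0.
  exists 0, (- u); split=> //; first by rewrite t0' mulr0.
    exact: signed_setN.
  by move: Fx; rewrite t0' !scale0r !addr0.
have tp : 0 < t by rewrite lt_neqAle eq_sym tn0.
have le_t : (tau%:E * min_time (S (~~ b)) (x + t *: u)%R (F (x + t *: u)%R)
    <= (tau * t)%:E)%E.
  by rewrite EFinM lee_pmul2l // ?lte_fin //; exact: min_time_step.
have taut : ((tau * t)%:E < (q * t)%:E)%E by rewrite lte_fin ltr_pM2r.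
have /regb Ty := le_lt_trans le_t (lt_trans taut qtU).
have [t' [u' [t'0 /ltW t'q Su' Fu']]] :=
  min_time_lt (le_lt_trans (le_trans (Ty Uy) le_t) taut).
by exists t', u'.
Qed.

(** The iteration runs on states made of a sign, a point, a step length and a direction, since each
    step depends on the one before it. *)
Lemma exists_orbit b x0 (r : R) :
  (min_time (S b) x0 (inv_map F x0) < ((1 - tau) * r)%:E)%E ->
  (r%:E < ndist x0 (~` U))%E ->
  exists q (x : nat -> X) (t : nat -> R) (u : nat -> X),
  [/\ 0 < q < 1, x 0 = x0, t 0 <= (1 - q) * r,
      forall k, x k.+1 = x k + t k *: u k &
      forall k, [/\ 0 <= t k, t k.+1 <= q * t k, S (b (+) odd k) (u k) &
                    F (x k.+1) (x k)]].
Proof.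
move=> Tr rU; have [tau0 _] := regF b.
(* The room left below [(1 - tau) * r] is what makes [q] exceed [tau]. *)
have [c Tc cr] : exists2 c, (min_time (S b) x0 (inv_map F x0) < c%:E)%E
    & c < (1 - tau) * r.
  have := min_time_ge0 (S b) x0 (inv_map F x0).
  case: (min_time _ _ _) Tr => [T| |] // + _.
  rewrite lte_fin => /(@midf_lt _ T) [Tm mr].
  by eexists; [rewrite lte_fin; exact: Tm|exact: mr].
have c0 : 0 < c by rewrite -lte_fin; apply: le_lt_trans Tc; exact: min_time_ge0.
have r0 : 0 < r by rewrite -(@pmulr_rgt0 _ (1 - tau)) ?subr_gt0 //; exact: lt_trans cr.
(* With this ratio, steps starting at [c] have geometric sum [c / (1 - q) = r]. *)
pose q := 1 - c / r.
have cE : c = (1 - q) * r by rewrite /q; field; rewrite gt_eqF.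
have q1 : q < 1 by rewrite /q ltrBlDr ltrDl divr_gt0.
have tauq : tau < q.
  by rewrite /q ltrBrDl -ltrBrDr ltr_pdivrMr.
have q0 : 0 < q by lra.
pose state := (bool * X * R * X)%type.
pose stp (s : state) := s.1.1.2 + s.1.2 *: s.2.
(* The last clause says that a geometric tail of ratio [q] starting with the
   current step cannot leave the ball of radius [r] around [x0]. *)
pose inv (s : state) :=
  [/\ 0 <= s.1.2, S s.1.1.1 s.2, F (stp s) s.1.1.2 &
      `|x0 - s.1.1.2| * (1 - q) + s.1.2 <= (1 - q) * r].
pose nxt (s s' : state) := inv s ->
  [/\ inv s', s'.1.1.1 = ~~ s.1.1.1, s'.1.1.2 = stp s & s'.1.2 <= q * s.1.2].
have [f fP] : {f : state -> state & forall s, nxt s (f s)}.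
  apply: choice => -[[[b' x] t] u].
  rewrite /nxt /inv /stp /=.
  (* Where the invariant fails, [nxt] holds vacuously and the state itself serves as default. *)
  have [invs|ninvs] := pselect (inv (b', x, t, u)); last first.
    by exists (b', x, t, u) => /ninvs.
  have [/= t0 Su Fx xr] := invs.
  have xy : `|x0 - (x + t *: u)| <= `|x0 - x| + t.
    rewrite opprD addrA (le_trans (ler_normB _ _)) // normrZ.
    by rewrite (signed_set_norm Su) mulr1 ger0_norm.
  (* Moving by [t] adds at most [t * (1 - q)] to the first term, exactly what replacing [t] by
     [q * t] saves. *)
  have xyr : `|x0 - (x + t *: u)| * (1 - q) + q * t <= (1 - q) * r by nra.
  have Uy : U (x + t *: u).
    apply: (ndist_gt_mem rU); rewrite -(@ler_pM2r _ (1 - q)); nra.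
  have qtU : ((q * t)%:E < ndist (x + t *: u)%R (~` U))%E.
    apply: (ndist_gt_shift rU).
    by rewrite -(@ler_pM2r _ (1 - q)); nra.
  have [t' [u' [t'0 t'q Su' Fy]]] := next_step tauq t0 Su Fx Uy qtU.
  exists (~~ b', x + t *: u, t', u') => _; split=> //; split=> //=.
  by lra.
have [t0 [u0 [t00 t0c Su0 Fx0]]] := min_time_lt Tc.
pose s k := iter k f (b, x0, t0, u0).
have invs k : inv (s k).
  elim: k => [|k /fP[]//]; split=> //=.
  by rewrite subrr normr0 mul0r add0r -cE ltW.
have sP k := fP _ (invs k).
have bs k : (s k).1.1.1 = b (+) odd k.
  elim: k => [|k IH]; first by rewrite addbF.
  by rewrite [odd _]/= addbN -IH; have [] := sP k.
exists q, (fun k => (s k).1.1.2), (fun k => (s k).1.2), (fun k => (s k).2).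
split=> //.
- by rewrite q0 q1.
- by rewrite /= -cE ltW.
- by move=> k; have [_ _ -> _] := sP k.
move=> k; have [_ _ xE tq] := sP k; have [tk0 Sk Fk _] := invs k.
by split=> //; [rewrite -bs|rewrite xE].
Qed.


(** The ratio [q] is used up here: it gives the null limit, the Cauchy property and, from
    [t 0 <= (1 - q) * r], the radius [r]. *)
Lemma exists_cvg_orbit b x0 (r : R) :
  (min_time (S b) x0 (inv_map F x0) < ((1 - tau) * r)%:E)%E ->
  (r%:E < ndist x0 (~` U))%E ->
  exists (x : nat -> X) (t : nat -> R) (u : nat -> X),
  [/\ x 0 = x0, t @ \oo --> (0 : R), cauchy (x @ \oo),
      forall k, U (x k) /\ `|x0 - x k| <= r &
      forall k, [/\ 0 <= t k, S (b (+) odd k) (u k), x k.+1 = x k + t k *: u k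
                  & F (x k.+1) (x k)]].
Proof.
move=> Tr rU.
have [q [x [t [u [q01 x00 tr xS xP]]]]] := exists_orbit Tr rU.
have t0 k : 0 <= t k by have [] := xP k.
have tq k : t k.+1 <= q * t k by have [] := xP k.
have xt k : `|x k - x k.+1| <= t k.
  have [_ _ Su _] := xP k.
  rewrite xS opprD addrA subrr add0r normrN normrZ (signed_set_norm Su).
  by rewrite mulr1 ger0_norm.
have xr k : `|x0 - x k| <= r.
  have := geometric_steps_dist q01 tq xt 0 k; rewrite add0n x00 => xk.
  have /andP[_ q1] := q01.
  by rewrite -(@ler_pM2r _ (1 - q)) ?subr_gt0 //; have := t0 k; lra.
exists x, t, u; split=> //.
- exact: geometric_steps_cvg0 q01 t0 tq.
- exact: geometric_steps_cauchy q01 t0 tq xt.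
- by move=> k; split=> //; exact: ndist_gt_mem rU (xr k).
- by move=> k; have [] := xP k.
Qed.

Lemma exists_approx_fix b x0 (r eps : R) : 0 < eps ->
  (min_time (S b) x0 (inv_map F x0) < ((1 - tau) * r)%:E)%E ->
  (r%:E < ndist x0 (~` U))%E ->
  exists2 a, (approx_fix F eps `&` U) a & `|x0 - a| <= r.
Proof.
move=> eps0 Tr rU.
have [x [t [u [_ tcvg _ xr xP]]]] := exists_cvg_orbit Tr rU.
have [N _ /(_ N (leqnn N)) /= tN] := cvgr_lt _ tcvg _ eps0.
have [t0 Su xS Fx] := xP N; have [Ux xNr] := xr N.+1.
exists (x N.+1) => //; split=> //.
rewrite xS in Fx *; apply: le_trans (approx_fix_step t0 Su Fx) _.
by rewrite lee_fin ltW.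
Qed.

(** The pairs [(x k.+1, x k)] lie in the graph and tend to [(a, a)], so closedness makes the limit
    [a] a fixed point. *)
Lemma exists_fix b x0 (r : R) : is_banach X -> closed (graph_map F) ->
  (min_time (S b) x0 (inv_map F x0) < ((1 - tau) * r)%:E)%E ->
  (r%:E < ndist x0 (~` U))%E ->
  exists2 a, (fix_set F `&` U) a & `|x0 - a| <= r.
Proof.
move=> banX clF Tr rU.
have [x [t [u [_ _ xcauchy xr xP]]]] := exists_cvg_orbit Tr rU.
have /cvg_ex[a xa] : cvg (x @ \oo) by exact: banX.
have ar : `|x0 - a| <= r.
  apply: (cvgr_to_le (cvg_norm (cvgB (cvg_cst x0) xa))).
  by apply: nearW => k; have [] := xr k.
(* The limit stays in [U] because the closed ball of radius [r] about [x0] does. *)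
exists a => //; split; last exact: ndist_gt_mem rU ar.
have : graph_map F (a, a).
  apply: (@closed_cvg _ _ \oo _ (fun k => (x k.+1, x k))) clF _ _ _.
    by apply: nearW => k; have [] := xP k.
  by apply: cvg_pair => //=; rewrite cvg_shiftS.
by [].
Qed.

End orbit.

(** * From orbits to successive approximations and distance estimates *)

Unset Implicit Arguments.
Set Strict Implicit.

Theorem theorem3p1 (R : realType) (X : normedModType R) (F : X -> set X)
    (U L : set X) (tau : R) (xbar : X)
    (hUopen : open U) (hU0 : U !=set0)
    (hL0 : L !=set0) (hL : L `<=` unit_sphere X)
    (htau : 0 < tau < 1)
    (hregL : dir_orbitally_regular F U L tau)
    (hregNL : dir_orbitally_regular F U (opp_set L) tau)
    (hxbar : U xbar)
    (hab :
      (min_time L xbar (inv_map F xbar) <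
         (1 - tau)%:E * ndist xbar (~` U))%E \/
      (min_time (opp_set L) xbar (inv_map F xbar) <
         (1 - tau)%:E * ndist xbar (~` U))%E) :
  (* (a) *)
  ((exists x : nat -> X,
      successive_approx (inv_map F) L xbar x /\
      forall eps : R, 0 < eps ->
        exists keps : nat, forall k : nat, (keps <= k)%N ->
          (approx_fix F eps `&` U) (x k) /\
          ((min_time L (x k) (F (x k)) < eps%:E)%E \/
           (min_time (opp_set L) (x k) (F (x k)) < eps%:E)%E)) /\
   (forall eps : R, 0 < eps ->
      ((min_time L xbar (inv_map F xbar) <
          (1 - tau)%:E * ndist xbar (~` U))%E ->
       (ndist xbar (approx_fix F eps `&` U) <=
          min_time L xbar (inv_map F xbar) / (1 - tau)%:E)%E) /\
      ((min_time (opp_set L) xbar (inv_map F xbar) <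
          (1 - tau)%:E * ndist xbar (~` U))%E ->
       (ndist xbar (approx_fix F eps `&` U) <=
          min_time (opp_set L) xbar (inv_map F xbar) / (1 - tau)%:E)%E))) /\
  (* (b) *)
  (is_banach X -> closed (graph_map F) ->
   fix_set F `&` U !=set0 /\
   ((min_time L xbar (inv_map F xbar) <
       (1 - tau)%:E * ndist xbar (~` U))%E ->
    (ndist xbar (fix_set F `&` U) <=
       min_time L xbar (inv_map F xbar) / (1 - tau)%:E)%E) /\
   ((min_time (opp_set L) xbar (inv_map F xbar) <
       (1 - tau)%:E * ndist xbar (~` U))%E ->
    (ndist xbar (fix_set F `&` U) <=
       min_time (opp_set L) xbar (inv_map F xbar) / (1 - tau)%:E)%E)).
Proof.
have /andP[tau0 tau1] := htau; have tau1' : 0 < 1 - tau by rewrite subr_gt0.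
have reg b : dir_orbitally_regular F U (signed_set L b) tau by case: b.
have [b hb] : exists b, (min_time (signed_set L b) xbar (inv_map F xbar) <
    (1 - tau)%:E * ndist xbar (~` U))%E.
  by case: hab => [h|h]; [exists false|exists true].
have [r Tr rU] := lte_fin_mul_between tau1' (min_time_ge0 _ _ _) hb.
have dist_approx eps b' : 0 < eps ->
    (min_time (signed_set L b') xbar (inv_map F xbar) <
      (1 - tau)%:E * ndist xbar (~` U))%E ->
    (ndist xbar (approx_fix F eps `&` U) <=
      min_time (signed_set L b') xbar (inv_map F xbar) / (1 - tau)%:E)%E.
  move=> eps0 hb'; apply: (ndist_le_div tau1 (min_time_ge0 _ _ _) hb') => r'.
  exact: exists_approx_fix tau1 hL reg _ _ _ _ eps0.
split; [split|].
- have [x [t [u [x0 tcvg _ xr xP]]]] := exists_cvg_orbit tau1 hL reg Tr rU.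
  pose sgn k := b (+) odd k.
  exists x; split.
    (* Directions in [-L] are replaced by their opposites in [L]; the sign moves to the step length,
       which may be negative. *)
    exists (fun k => if sgn k then - t k else t k),
           (fun k => if sgn k then - u k else u k); split=> //.
    + apply: (@squeeze_cvgr _ _ _ _ (fun k => - t k) t) => //.
        apply: nearW => k; have [t0 _ _ _] := xP k.
        by case: ifP => _; lra.
      by rewrite -oppr0; exact: cvgN.
    + move=> k; have [_ + _ _] := xP k; rewrite -/(sgn k).
      by case: (sgn k) => // -[v Lv <-]; rewrite opprK.
    + move=> k; have [_ _ -> Fx] := xP k; split; last exact: Fx.
      by case: ifP => _ //; rewrite scaleNr scalerN opprK.
  move=> eps eps0; have [N _ tN] := cvgr_lt _ tcvg _ eps0.
  (* The point [x k.+1] is controlled by step [k], hence the shift to [N.+1]. *)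
  exists N.+1 => -[//|k] Nk; have /= tk := tN k Nk.
  have [t0 Su xS Fx] := xP k; have [Ux _] := xr k.+1; split.
    split=> //; rewrite xS in Fx *.
    apply: le_trans (approx_fix_step hL t0 Su Fx) _.
    by rewrite lee_fin ltW.
  (* The way back has the opposite sign, which decides between [L] and [-L]. *)
  have : (min_time (signed_set L (~~ sgn k)) (x k.+1) (F (x k.+1)) < eps%:E)%E.
    rewrite xS in Fx *; apply: le_lt_trans (min_time_step t0 Su Fx) _.
    by rewrite lte_fin.
  by case: (sgn k); [left|right].
- move=> eps eps0; split; first exact: (dist_approx eps false).
  exact: (dist_approx eps true).
move=> banX clF.
have dist_fix b' : (min_time (signed_set L b') xbar (inv_map F xbar) <
      (1 - tau)%:E * ndist xbar (~` U))%E ->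
    (ndist xbar (fix_set F `&` U) <=
      min_time (signed_set L b') xbar (inv_map F xbar) / (1 - tau)%:E)%E.
  move=> hb'; apply: (ndist_le_div tau1 (min_time_ge0 _ _ _) hb') => r'.
  exact: exists_fix tau1 hL reg _ _ _ banX clF.
split; first by have [a Fa _] := exists_fix tau1 hL reg banX clF Tr rU; exists a.
by split; [exact: (dist_fix false)|exact: (dist_fix true)].
Qed.
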